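(* Let $B$ be a unital $\mathbb K$-algebra. For $F,G\in G_B^{\mathrm{inv}}$, let $F\circledast G:=S^l\big(S^l(F)\bullet S^l(G)\big)$ be the boxed convolution. Then $$F\circledast G=G\star_l S^l\big(G\rhd_r S^l(F)\big),\qquad F\circledast G=F\star_r S^r\big(F\rhd_l S^r(G)\big).$$
   Context: $\mathbb K$ is a field of characteristic zero. For a unital $\mathbb K$-algebra $B$, $\mathrm{Mult}[[B]]$ is the set of sequences $f=(f_n)_{n\ge0}$ of $\mathbb K$-multilinear maps $f_n:B^{\otimes n}\to B$ (with $B^{\otimes 0}=\mathbb K$, so $f_0$ is identified with an element of $B$). Product: $(f\cdot g)_n(x_1,\dots,x_n)=\sum_{k=0}^n f_k(x_1,\dots,x_k)\,g_{n-k}(x_{k+1},\dots,x_n)$, also written $fg$, with unit $1=(\delta_{n,0}1)_n$. Composition, when $g_0=0$: $(f\circ g)_n(x_1,\dots,x_n)=\sum_{l\ge0}\sum_{k_1+\cdots+k_l=n,\,k_i\ge1}f_l\big(g_{k_1}(x_1,\dots,x_{k_1}),\dots,g_{k_l}(x_{n-k_l+1},\dots,x_n)\big)$, with unit $I=(\delta_{n,1}\mathrm{Id})_n$. Composition takes precedence over multiplication: $f\cdot g\circ h\cdot k=f\cdot(g\circ h)\cdot k$. $G_B^{\mathrm{inv}}=\{f: f_0\in B^\times\}$ is a group for $\cdot$, with inverse $f^{-1}$; $G_B^{\mathrm{dif}}=\{f: f_0=0,\ f_1\in \mathrm{GL}(B)\}$ is a group for $\circ$, with inverse $f^{\circ-1}$.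 For $F,G\in G_B^{\mathrm{inv}}$: $F\rhd_l G:=G\circ(IF)$, $F\rhd_r G:=G\circ(FI)$; $F\star_l G:=G\cdot F\circ(IG)$, $F\star_r G:=F\circ(GI)\cdot G$, $F\bullet G:=G\cdot F\circ(G^{-1}IG)$; $S^l(F):=F^{-1}\circ(IF)^{\circ-1}$, $S^r(F):=F^{-1}\circ(FI)^{\circ-1}$ (equivalently $I\cdot S^l(F)=(IF)^{\circ-1}$ and $S^r(F)\cdot I=(FI)^{\circ-1}$). *)

(* Defs.v *)
From HB Require Import structures.
From mathcomp Require Import all_boot all_algebra.
From mathcomp Require Import boolp classical_sets.

Set Implicit Arguments.
Unset Strict Implicit.
Unset Printing Implicit Defensive.

Import GRing.Theory.
Local Open Scope ring_scope.

Declare Scope mult_scope.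
Delimit Scope mult_scope with mult.

Reserved Notation "f \cdot g" (at level 40, left associativity).
(* Tighter than [\cdot]: composition takes precedence over multiplication. *)
Reserved Notation "f \circ g" (at level 35, right associativity).

(* A sequence (f_n)_n of maps f_n : B^n -> B is encoded as one function on
   [seq B], the disjoint union of the B^n: f_n (x_1, ..., x_n) is
   [f [:: x_1; ...; x_n]], and in particular f_0 is [f [::]]. The condition
   below says that every f_n is K-linear in each of its n arguments. *)
Definition multilinear (K : fieldType) (B : algType K) (f : seq B -> B) : Prop :=
  forall (s t : seq B) (a : K) (x y : B),
    f (s ++ (a *: x + y) :: t) = a *: f (s ++ x :: t) + f (s ++ y :: t).

Record Mult (K : fieldType) (B : algType K) := MkMult {
  mfun :> seq B -> B;
  mfunP : multilinear mfun }.
Bind Scope mult_scope with Mult.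

HB.instance Definition _ (K : fieldType) (B : algType K) := gen_eqMixin (Mult B).
HB.instance Definition _ (K : fieldType) (B : algType K) := gen_choiceMixin (Mult B).

Section Operations.
Variables (K : fieldType) (B : algType K).
Implicit Types (f g F G : Mult B) (s t : seq B).

Definition mone_fun s : B := if s is [::] then 1 else 0.

Definition mid_fun s : B := if s is [:: x] then x else 0.

Definition mmul_fun (f g : seq B -> B) s : B :=
  \sum_(k < (size s).+1) f (take k s) * g (drop k s).

(* The inner sum is over the l-tuples k of integers >= 1 of sum n := size s;
   such tuples exist only if l <= n and have entries <= n, hence the bounds.
   [reshape k s] cuts s into consecutive blocks of sizes k_1, ..., k_l.
   The value g_0 is not used. *)
Definition mcomp_fun (f g : seq B -> B) s : B :=
  \sum_(l < (size s).+1)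
    \sum_(k : l.-tuple 'I_(size s).+1 |
          all (fun i : 'I_(size s).+1 => 0 < i)%N k
          && (sumn (map val k) == size s))
      f (map g (reshape (map val k) s)).

Lemma mone_subproof : multilinear mone_fun.
Proof. by move=> [|? ?] t a x y /=; rewrite scaler0 addr0. Qed.

Lemma mid_subproof : multilinear mid_fun.
Proof.
by move=> [|? [|? ?]] [|? ?] a x y //=; rewrite scaler0 addr0.
Qed.

Lemma mmul_subproof f g : multilinear (mmul_fun f g).
Proof.
move=> s t a x y; rewrite /mmul_fun !size_cat /= scaler_sumr -big_split /=.
apply: eq_bigr => k _; rewrite !take_cat !drop_cat.
case: ltnP => [_|]; first by rewrite mfunP mulrDr scalerAr.
case: (k - size s)%N => [|j] _ /=.
  by have /= -> := mfunP g [::] t a x y; rewrite mulrDr scalerAr.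
by rewrite mfunP mulrDl scalerAl.
Qed.

Lemma reshape_slot (sh : seq nat) s t :
  (size s < sumn sh)%N ->
  exists b c u v, forall z, reshape sh (s ++ z :: t) = b ++ (u ++ z :: v) :: c.
Proof.
elim: sh s => [|n sh IH] s //=.
case: (ltnP (size s) n) => [lt_sn _|le_ns lt_s].
  exists [::], (reshape sh (drop (n - size s).-1 t)), s, (take (n - size s).-1 t).
  move=> z; rewrite take_cat drop_cat ltnNge (ltnW lt_sn) /=.
  by rewrite -subn_gt0 in lt_sn; case: (n - size s)%N lt_sn.
have [|b [c [u [v E]]]] := IH (drop n s).
  by rewrite size_drop ltn_subLR.
exists (take n s :: b), c, u, v => z.
rewrite take_cat drop_cat; case: ltngtP le_ns => // [_|eq_ns] _.
  by rewrite E.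
move: (E z); rewrite eq_ns drop_size subnn take0 cats0 take_size drop0 /=.
by move=> ->.
Qed.

Lemma mcomp_subproof f g : multilinear (mcomp_fun f g).
Proof.
move=> s t a x y; rewrite /mcomp_fun !size_cat /= scaler_sumr -big_split /=.
apply: eq_bigr => l _; rewrite scaler_sumr -big_split /=.
apply: eq_bigr => k /andP[_ /eqP sum_k].
have [|b [c [u [v E]]]] := @reshape_slot (map val k) s t.
  by rewrite sum_k addnS ltnS leq_addr.
by rewrite !E !map_cat /= mfunP mfunP.
Qed.

Definition mone : Mult B := MkMult mone_subproof.
Definition mid : Mult B := MkMult mid_subproof.
Definition mmul f g : Mult B := MkMult (mmul_subproof f g).
Definition mcomp f g : Mult B := MkMult (mcomp_subproof f g).

Definition Ginv : set (Mult B) :=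
  [set f | exists v : B, f [::] * v = 1 /\ v * f [::] = 1].

(* f_1 is linear by multilinearity, so bijectivity means f_1 \in GL(B). *)
Definition Gdif : set (Mult B) :=
  [set f | f [::] = 0 /\ bijective (fun x : B => f [:: x])].

(* Inverses in the groups (Ginv, mmul, mone) and (Gdif, mcomp, mid);
   outside of these groups the values are irrelevant defaults. *)
Definition minv f : Mult B :=
  xget mone [set g | Ginv g /\ mmul f g = mone /\ mmul g f = mone].
Definition mcinv f : Mult B :=
  xget mid [set g | Gdif g /\ mcomp f g = mid /\ mcomp g f = mid].

End Operations.

Arguments mone {K B}.
Arguments mid {K B}.

Notation "f \cdot g" := (mmul f g) : mult_scope.
Notation "f \circ g" := (mcomp f g) : mult_scope.

Section BoxedConvolution.
Variables (K : fieldType) (B : algType K).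
Implicit Types F G : Mult B.
Local Open Scope mult_scope.
Local Notation I := (@mid K B).

Definition act_l F G : Mult B := G \circ (I \cdot F).
Definition act_r F G : Mult B := G \circ (F \cdot I).

Definition star_l F G : Mult B := G \cdot F \circ (I \cdot G).
Definition star_r F G : Mult B := F \circ (G \cdot I) \cdot G.
Definition bullet F G : Mult B := G \cdot F \circ (minv G \cdot I \cdot G).

Definition S_l F : Mult B := minv F \circ mcinv (I \cdot F).
Definition S_r F : Mult B := minv F \circ mcinv (F \cdot I).

Definition boxed F G : Mult B := S_l (bullet (S_l F) (S_l G)).

End BoxedConvolution.

(* Main.v *)
Require Import Defs.
From mathcomp Require Import all_boot all_algebra.
From mathcomp Require Import boolp classical_sets.

(** Write I for the unit of composition, A = S_l F, C = S_l G,
    E = A \circ (G I) and D = S_l E. The map X |-> I X turns S_l into inversion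
    for composition, and it is injective; likewise X |-> X I for S_r. So every
    identity between such sequences may be tested after multiplying by I, where
    it becomes an identity between composition inverses.

    First formula ([boxed_star_l]). Since (I C)^-1 = I G for composition, one has
    G \circ (I C) = C^-1, hence C^-1 I C = (G I) \circ (I C), and
    right distributivity of composition gives
    I (A \bullet C) = (I E) \circ (I C).
    Its composition inverse is (I G) \circ (I D) = I (G \star_l D), which is the
    claim.

    Second formula ([star_l_star_r]). The right-hand side of the first one is
    D (G \circ (I D)). Put X = G \circ (I D) and w = (G I) \circ (I D) = X I D.
    From D (E \circ (I D)) = 1 and E \circ (I D) = A \circ w one gets
    (I A) \circ w = w D^-1 = X I, and composing F \circ (I A) = A^-1 with w yields
    D = F \circ (X I). Hence D X = (F \circ (X I)) X = F \star_r X. It remains to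
    see that X = S_r (S_r G \circ (I F)), that is
    (S_r G \circ (I F) \circ (X I)) X I = I; here
    (I F) \circ (X I) = X I D = w, and S_r G \circ (G I) = G^-1 turns the first
    factor into G^-1 \circ (I D) = X^-1.

    What this computation needs from the two products is that both are associative
    and unital (I being a left unit for sequences with zero constant term), that
    composition distributes on the right over multiplication
    ([mmul_comp]), and that the inverses occurring in the definitions of S_l and
    S_r exist. The monoid laws come from a recursive description of composition:
    splitting off the block that contains the first argument gives
      (f \circ g) (x :: s) = sum over s = u ++ v of (f_b \circ g) v,
    where b = g (x :: u) and f_b t = f (b :: t) ([mcomp_cons]). Here f is allowed
    to vary, so inductions on the length of s go through for all f at once, and
    associativity and distributivity reduce to the coassociativity of
    deconcatenation s |-> u ++ v.
    Inverses are fixed points of maps that gain one degree of precision at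
    each application ([contraction_fixpoint]). *)

Set Implicit Arguments.
Unset Strict Implicit.
Unset Printing Implicit Defensive.
Import GRing.Theory.
Local Open Scope ring_scope.

(** * Sums over the ways to cut a word in two *)

Section Deconcatenation.
Variables (T : Type) (V : zmodType).
Implicit Types (s u v : seq T).

(** The structural form of the sum over all s = u ++ v: it makes
    coassociativity a plain induction on the word. *)
Fixpoint dsum (phi : seq T -> seq T -> V) s : V :=
  phi [::] s +
  if s is x :: s' then dsum (fun u v => phi (x :: u) v) s' else 0.

Lemma dsumE phi s :
  dsum phi s = \sum_(k < (size s).+1) phi (take k s) (drop k s).
Proof.
elim: s phi => [|x s IH] phi /=; first by rewrite big_ord1 addr0.
by rewrite big_ord_recl /= IH.
Qed.

Lemma eq_dsum phi psi s :
  (forall u v, s = u ++ v -> phi u v = psi u v) -> dsum phi s = dsum psi s.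
Proof.
by move=> e; rewrite !dsumE; apply: eq_bigr => k _; rewrite e // cat_take_drop.
Qed.

Lemma dsumD phi psi s :
  dsum (fun u v => phi u v + psi u v) s = dsum phi s + dsum psi s.
Proof. by rewrite !dsumE -big_split. Qed.

(** Cutting twice gives the same triples whichever side is cut again. *)
Lemma dsum_coassoc (phi : seq T -> seq T -> seq T -> V) s :
  dsum (fun u v => dsum (phi u) v) s =
  dsum (fun u v => dsum (fun u1 u2 => phi u1 u2 v) u) s.
Proof.
elim: s phi => [|x s IH] phi //=.
rewrite IH dsumD. by rewrite addr0 addrA.
Qed.

Lemma dsum_suffix0 phi s :
  (forall u x v, phi u (x :: v) = 0) -> dsum phi s = phi s [::].
Proof.
elim: s phi => [|x s IH] phi phi0 /=; first by rewrite addr0.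
by rewrite phi0 add0r IH.
Qed.

Lemma dsum_prefix0 phi s :
  (forall x u v, phi (x :: u) v = 0) -> dsum phi s = phi [::] s.
Proof.
by case: s => [|x s] phi0 /=; rewrite ?addr0 // dsumE big1 ?addr0.
Qed.

End Deconcatenation.

Lemma raddf_dsum (T : Type) (V W : zmodType) (L : V -> W) phi (s : seq T) :
  L 0 = 0 -> {morph L : x y / x + y} ->
  L (dsum phi s) = dsum (fun u v => L (phi u v)) s.
Proof. by move=> L0 LD; rewrite !dsumE (big_morph L LD L0). Qed.

(** * Composition as a recursion on the first block *)

(** The integer compositions of n, listed in exactly the order in which the two
    nested sums of [mcomp_fun] enumerate them, so that these sums collapse into
    one without any rearrangement. *)
Definition parts (n : nat) : seq (seq nat) :=
  [seq map val (k : seq 'I_n.+1) | l : nat <- map val (enum 'I_n.+1),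
     k <- [seq k <- map val (enum {: l.-tuple 'I_n.+1})
          | all (fun i : 'I_n.+1 => 0 < i)%N k && (sumn (map val k) == n)]].

Lemma size_le_sumn (c : seq nat) :
  all (fun i => 0 < i)%N c -> (size c <= sumn c)%N.
Proof.
elim: c => //= i c IH /andP[i0 /IH le_c].
by rewrite -add1n leq_add.
Qed.

Lemma mem_parts n c :
  (c \in parts n) = all (fun i => 0 < i)%N c && (sumn c == n).
Proof.
apply/allpairsPdep/idP => [[l [k [_]]]|/andP[c0 /eqP sum_c]].
  by rewrite mem_filter => /andP[/andP[k0 sum_k] _] ->; rewrite all_map k0.
have c_le i : i \in c -> (i < n.+1)%N.
  by move=> ci; rewrite ltnS -sum_c (perm_sumn (perm_to_rem ci)) leq_addr.
pose k : seq 'I_n.+1 := map inord c.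
have Ek : map val k = c.
  by rewrite -map_comp -[RHS]map_id; apply/eq_in_map => i /c_le /= /inordK.
have k0 : all (fun i : 'I_n.+1 => 0 < i)%N k by rewrite -[c]Ek all_map in c0.
exists (size c), k; split=> //.
  have lt_c : (size c < n.+1)%N by rewrite ltnS -sum_c size_le_sumn.
  by apply/mapP; exists (Ordinal lt_c); rewrite ?mem_enum.
rewrite mem_filter k0 Ek sum_c eqxx /=.
have szk : size k == size c by rewrite size_map.
by apply/mapP; exists (Tuple szk); rewrite ?mem_enum.
Qed.

Lemma parts_uniq n : uniq (parts n).
Proof.
apply: allpairs_uniq_dep.
- by rewrite map_inj_uniq ?enum_uniq //; apply: val_inj.
- move=> l _; rewrite filter_uniq // map_inj_uniq ?enum_uniq //.
  exact: val_inj.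
move=> p q /allpairsPdep[l [k [_ lk ->]]] /allpairsPdep[l' [k' [_ lk' ->]]] /=.
move: lk lk'; rewrite !mem_filter => /andP[_ /mapP[t _ ->]].
move=> /andP[_ /mapP[t' _ ->]] /= /(inj_map val_inj) E.
have El : l = l' by rewrite -(size_tuple t) E size_tuple.
by rewrite E El.
Qed.

Lemma parts0 : parts 0 = [:: [::]].
Proof.
apply: perm_small_eq => //; apply: uniq_perm (parts_uniq 0) _ _ => // c.
rewrite mem_parts inE; apply/andP/eqP => [[c0 /eqP sum_c]|-> //].
by apply/size0nil/eqP; rewrite -leqn0 -sum_c size_le_sumn.
Qed.

(** A composition of n + 1 is a first part k + 1 followed by a composition of
    what is left; both lists are duplicate-free, so equality of their members
    suffices. *)
Lemma partsS n :
  perm_eq (parts n.+1)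
          [seq k.+1 :: c | k <- index_iota 0 n.+1, c <- parts (n - k)].
Proof.
apply: uniq_perm (parts_uniq _) _ _.
  apply: allpairs_uniq_dep => [|k _|]; rewrite ?iota_uniq ?parts_uniq //.
  by move=> [k c] [k' c'] _ _ /= [<- <-].
move=> c; rewrite mem_parts; apply/idP/allpairsPdep => [|[k [d [lek]]]].
  case: c => [|[|k] c] //= /andP[c0]; rewrite addSn eqSS => /eqP sum_c.
  exists k, c; split=> //; first by rewrite mem_index_iota ltnS -sum_c leq_addr.
  by rewrite mem_parts c0 -sum_c addKn eqxx.
rewrite mem_parts => /andP[d0 /eqP sum_d] -> /=.
by rewrite mem_index_iota ltnS in lek; rewrite d0 sum_d addSn /= subnKC.
Qed.

Section RawComposition.
Variables (K : fieldType) (B : algType K).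
Implicit Types (f g h : seq B -> B) (s u v : seq B).

Lemma mcomp_funE f g s :
  mcomp_fun f g s = \sum_(c <- parts (size s)) f (map g (reshape c s)).
Proof.
rewrite /mcomp_fun /parts big_allpairs_dep big_map big_enum /=.
apply: eq_bigr => l _.
by rewrite big_filter big_map big_enum_cond.
Qed.

Lemma mcomp_nil f g : mcomp_fun f g [::] = f [::].
Proof. by rewrite mcomp_funE parts0 big_seq1. Qed.

(** The first block is [x :: u]. Absorbing its value into the outer function
    leaves a composition over the shorter word [v] with another outer function:
    inductions on the word have to quantify over f. *)
Lemma mcomp_cons f g x s :
  mcomp_fun f g (x :: s) =
  dsum (fun u v => mcomp_fun (fun t => f (g (x :: u) :: t)) g v) s.
Proof.
rewrite mcomp_funE (perm_big _ (partsS _)) big_allpairs_dep /= dsumE.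
rewrite big_mkord.
by apply: eq_bigr => k _; rewrite mcomp_funE size_drop.
Qed.

Lemma eq_mcomp_l f1 f2 g s : f1 =1 f2 -> mcomp_fun f1 g s = mcomp_fun f2 g s.
Proof. by move=> e; rewrite !mcomp_funE; apply: eq_bigr => c _; rewrite e. Qed.

Lemma raddf_mcomp (L : B -> B) f g s :
  L 0 = 0 -> {morph L : x y / x + y} ->
  L (mcomp_fun f g s) = mcomp_fun (fun t => L (f t)) g s.
Proof. by move=> L0 LD; rewrite !mcomp_funE (big_morph L LD L0). Qed.

Lemma mcompDl f1 f2 g s :
  mcomp_fun (fun t => f1 t + f2 t) g s = mcomp_fun f1 g s + mcomp_fun f2 g s.
Proof. by rewrite !mcomp_funE -big_split. Qed.

Lemma mcomp0l g s : mcomp_fun (fun=> 0) g s = 0.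
Proof. by rewrite mcomp_funE big1. Qed.

(** Applied with b = 1 this is 1 \circ g = 1; with general b it evaluates what
    remains of I once its first argument has been filled. *)
Lemma mcomp_at_nil (b : B) g s :
  mcomp_fun (fun t => if t is [::] then b else 0) g s =
  if s is [::] then b else 0.
Proof.
case: s => [|x s]; rewrite ?mcomp_nil // mcomp_cons dsum_prefix0 => *.
  exact: mcomp0l.
exact: mcomp0l.
Qed.

Lemma size_ind (P : seq B -> Prop) :
  (forall s, (forall t, (size t < size s)%N -> P t) -> P s) -> forall s, P s.
Proof.
move=> H s; have [n] := ubnP (size s); elim: n s => // n IH s lt_s.
by apply: H => t lt_t; apply: IH; apply: leq_trans lt_t _.
Qed.

(** Composition with h respects deconcatenation: a cut of the word of blocks is a
    cut of the underlying word that falls between two blocks. Right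
    distributivity over the product is the case of a product kernel, and
    associativity follows by taking the recursion of f \circ g as kernel. *)
Lemma mcomp_dsum (phi : seq B -> seq B -> B) h s :
  mcomp_fun (dsum phi) h s =
  dsum (fun u v => mcomp_fun (fun a => mcomp_fun (phi a) h v) h u) s.
Proof.
elim/size_ind: s phi => -[|x s] IH phi; first by rewrite /= !mcomp_nil /= !addr0.
rewrite mcomp_cons /= mcomp_nil mcomp_cons.
rewrite [in X in _ = _ + X](eq_dsum (fun u v _ => mcomp_cons _ h x u)).
rewrite -(dsum_coassoc (fun u1 u2 v => mcomp_fun (fun t =>
  mcomp_fun (phi (h (x :: u1) :: t)) h v) h u2)) -dsumD.
apply: eq_dsum => u v s_uv; rewrite mcompDl -IH // s_uv /=.
by rewrite size_cat ltnS leq_addl.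
Qed.

Lemma multilinear_cons f b : multilinear f -> multilinear (fun t => f (b :: t)).
Proof. by move=> mf s t a x y; apply: (mf (b :: s)). Qed.

Lemma multilinear_consD f t : multilinear f ->
  {morph (fun b => f (b :: t)) : x y / x + y}.
Proof. by move=> mf x y; have := mf [::] t 1 x y; rewrite !scale1r. Qed.

Lemma multilinear_cons0 f t : multilinear f -> f (0 :: t) = 0.
Proof.
move=> mf; apply: (addrI (f (0 :: t))).
by rewrite -(multilinear_consD t mf) !addr0.
Qed.

(** Only the linearity of the outermost f matters: on the right-hand side the
    first argument of f is a sum, over the ways to group the first blocks, and f
    has to be expanded along it. *)
Lemma mcomp_assoc_fun f g h s : multilinear f ->
  mcomp_fun (mcomp_fun f g) h s = mcomp_fun f (mcomp_fun g h) s.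
Proof.
elim/size_ind: s f => -[|x s] IH f mf; first by rewrite !mcomp_nil.
rewrite !mcomp_cons.
(* The part of the left-hand side that sees the first argument b of f. *)
pose L b v := mcomp_fun (mcomp_fun (fun t => f (b :: t)) g) h v.
transitivity (dsum (fun u v => dsum (fun v1 v2 =>
    mcomp_fun (fun a => L (g (h (x :: u) :: a)) v2) h v1) v) s).
  apply: eq_dsum => u v _; rewrite -mcomp_dsum.
  by apply: eq_mcomp_l => t; rewrite mcomp_cons.
rewrite (dsum_coassoc (fun u v1 v2 =>
    mcomp_fun (fun a => L (g (h (x :: u) :: a)) v2) h v1)).
apply: eq_dsum => u v s_uv.
have L0 : L 0 v = 0.
  rewrite -[RHS](mcomp0l h v); apply: eq_mcomp_l => t.
  rewrite -[RHS](mcomp0l g t); apply: eq_mcomp_l => t'.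
  exact: multilinear_cons0.
have LD : {morph L^~ v : b c / b + c}.
  move=> b c; rewrite -mcompDl; apply: eq_mcomp_l => t.
  rewrite -mcompDl; apply: eq_mcomp_l => t'; exact: multilinear_consD.
transitivity (L (mcomp_fun g h (x :: u)) v); last first.
  apply: IH; last exact: multilinear_cons.
  by rewrite s_uv /= size_cat ltnS leq_addl.
rewrite mcomp_cons (raddf_dsum _ _ L0 LD).
by apply: eq_dsum => u1 u2 _; rewrite (raddf_mcomp _ _ _ L0 LD).
Qed.

Lemma mcomp_id_r f s : multilinear f -> mcomp_fun f (mid_fun (B:=B)) s = f s.
Proof.
elim: s f => [|x s IH] f mf; first by rewrite mcomp_nil.
rewrite mcomp_cons dsum_prefix0 /=; first by rewrite IH //; exact: multilinear_cons.
move=> y u v; rewrite -[RHS](mcomp0l (mid_fun (B:=B)) v); apply: eq_mcomp_l => t.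
exact: multilinear_cons0.
Qed.

Lemma mcomp_id_l h s : h [::] = 0 -> mcomp_fun (mid_fun (B:=B)) h s = h s.
Proof.
case: s => [|x s] h0; first by rewrite mcomp_nil h0.
rewrite mcomp_cons dsum_suffix0 => [|u y v]; first by rewrite mcomp_nil.
exact: mcomp_at_nil.
Qed.

Lemma eq_mcomp_r f g h s :
  (forall t, (size t <= size s)%N -> g t = h t) ->
  mcomp_fun f g s = mcomp_fun f h s.
Proof.
elim/size_ind: s f => -[|x s] IH f gh; first by rewrite !mcomp_nil.
rewrite !mcomp_cons; apply: eq_dsum => u v s_uv.
have sz_s : size s = (size u + size v)%N by rewrite s_uv size_cat.
rewrite gh /= ?sz_s ?ltnS ?leq_addr //; apply: IH => [|t le_t].
  by rewrite /= sz_s ltnS leq_addl.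
by apply: gh; rewrite /= sz_s (leq_trans le_t) // -addSn leq_addl.
Qed.

End RawComposition.

(** * The laws of multiplication and composition *)

Section Monoids.
Variables (K : fieldType) (B : algType K).
Implicit Types (f g h : Mult B) (s u v : seq B).
Local Open Scope mult_scope.
Local Notation I := (@mid K B).

Lemma MultP f g : (forall s, f s = g s) -> f = g.
Proof.
case: f g => [f fP] [g gP] /= /funext fg; case: _ / fg gP => gP.
by rewrite (Prop_irrelevance fP gP).
Qed.

Lemma mmul_dsum f g s : (f \cdot g) s = dsum (fun u v => f u * g v) s.
Proof. by rewrite dsumE. Qed.

Lemma mmul_nil f g : (f \cdot g) [::] = f [::] * g [::].
Proof. by rewrite mmul_dsum /= addr0. Qed.

Lemma mcompE_nil f g : (f \circ g) [::] = f [::].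
Proof. exact: mcomp_nil. Qed.

Lemma mmul_mid_cons f x s : (I \cdot f) (x :: s) = x * f s.
Proof.
rewrite mmul_dsum /= mul0r add0r dsum_prefix0 // => y u v.
by rewrite mul0r.
Qed.

Lemma mmul_mid_rcons f s x : (f \cdot I) (rcons s x) = f s * x.
Proof.
rewrite mmul_dsum dsumE size_rcons big_ord_recr big_ord_recr /=.
rewrite -cats1 take_size_cat // drop_size_cat //= drop_oversize; last first.
  by rewrite size_cat addn1.
rewrite mulr0 addr0 big1 ?add0r // => k _; rewrite drop_cat ltn_ord.
by case: drop (size_drop k s) => [|y [|z t]]; rewrite ?mulr0 // => /esym/eqP;
   rewrite subn_eq0 leqNgt ltn_ord.
Qed.

Lemma mmulA f g h : f \cdot (g \cdot h) = f \cdot g \cdot h.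
Proof.
apply: MultP => s; rewrite !mmul_dsum.
transitivity (dsum (fun u v => dsum (fun v1 v2 => f u * g v1 * h v2) v) s).
  apply: eq_dsum => u v _; rewrite mmul_dsum.
  rewrite (raddf_dsum _ _ (mulr0 _) (mulrDr (f u))).
  by apply: eq_dsum => *; rewrite mulrA.
rewrite (dsum_coassoc (fun u v1 v2 => f u * g v1 * h v2)).
apply: eq_dsum => u v _; rewrite mmul_dsum.
by rewrite (raddf_dsum _ _ (mul0r (h v)) (fun x y => mulrDl x y (h v))).
Qed.

Lemma mmul1f f : mone \cdot f = f.
Proof.
apply: MultP => s; rewrite mmul_dsum dsum_prefix0 /= ?mul1r // => *.
by rewrite mul0r.
Qed.

Lemma mmulf1 f : f \cdot mone = f.
Proof.
apply: MultP => s; rewrite mmul_dsum dsum_suffix0 /= ?mulr1 // => *.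
by rewrite mulr0.
Qed.

Lemma mcompA f g h : f \circ (g \circ h) = (f \circ g) \circ h.
Proof. by apply: MultP => s; rewrite /= mcomp_assoc_fun //; case: f. Qed.

Lemma mcompf1 f : f \circ I = f.
Proof. by apply: MultP => s; apply: mcomp_id_r; case: f. Qed.

Lemma mcomp1f f : f [::] = 0 -> I \circ f = f.
Proof. by move=> f0; apply: MultP => s; apply: mcomp_id_l. Qed.

Lemma mone_comp f : mone \circ f = mone.
Proof. by apply: MultP => s; apply: mcomp_at_nil. Qed.

Lemma mmul_comp f g h : (f \cdot g) \circ h = f \circ h \cdot g \circ h.
Proof.
apply: MultP => s; rewrite mmul_dsum /=.
transitivity (mcomp_fun (dsum (fun u v => f u * g v)) h s).
  by apply: eq_mcomp_l => t; rewrite dsumE.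
rewrite mcomp_dsum; apply: eq_dsum => u v _ /=.
pose L b := b * mcomp_fun g h v.
rewrite -[RHS]/(L (mcomp_fun f h u)) raddf_mcomp /L ?mul0r // => [|x y];
  last by rewrite mulrDl.
apply: eq_mcomp_l => a.
by rewrite (raddf_mcomp _ _ _ (mulr0 (f a)) (mulrDr (f a))).
Qed.

(** (I f) (1 :: s) = f s, so f can be read off from I f. *)
Lemma mid_cancel_l f g : I \cdot f = I \cdot g -> f = g.
Proof.
move=> fg; apply: MultP => s; have := congr1 (fun a : Mult B => a (1 :: s)) fg.
by rewrite !mmul_mid_cons !mul1r.
Qed.

Lemma mid_cancel_r f g : f \cdot I = g \cdot I -> f = g.
Proof.
move=> fg; apply: MultP => s.
have := congr1 (fun a : Mult B => a (rcons s 1)) fg.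
by rewrite !mmul_mid_rcons !mulr1.
Qed.

Lemma mmul_mid_nil f : (I \cdot f) [::] = 0.
Proof. by rewrite mmul_nil mul0r. Qed.

Lemma mid_mmul_nil f : (f \cdot I) [::] = 0.
Proof. by rewrite mmul_nil mulr0. Qed.

End Monoids.

(** * Existence and uniqueness of inverses *)

Section Inverses.
Variables (K : fieldType) (B : algType K).
Implicit Types (f g h F G : Mult B) (s u v : seq B).
Local Open Scope mult_scope.
Local Notation I := (@mid K B).

Definition agree (n : nat) f g : Prop :=
  forall s, (size s < n)%N -> f s = g s.

Lemma agree_mul n f1 f2 g1 g2 :
  agree n f1 f2 -> agree n g1 g2 -> agree n (f1 \cdot g1) (f2 \cdot g2).
Proof.
move=> f12 g12 s lt_s; rewrite !mmul_dsum; apply: eq_dsum => u v s_uv.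
have sz_s : size s = (size u + size v)%N by rewrite s_uv size_cat.
by rewrite f12 ?g12 //; apply: leq_ltn_trans lt_s;
  rewrite sz_s ?leq_addr ?leq_addl.
Qed.

Lemma agree_comp n f g h : agree n g h -> agree n (f \circ g) (f \circ h).
Proof.
move=> gh s lt_s; apply: eq_mcomp_r => t le_t.
by apply: gh; apply: leq_ltn_trans lt_s.
Qed.

Lemma agree_mid_l n f g : agree n f g -> agree n.+1 (I \cdot f) (I \cdot g).
Proof.
by move=> fg [|x s] lt_s; rewrite ?mmul_mid_nil // !mmul_mid_cons fg.
Qed.

Lemma agree_mid_r n f g : agree n f g -> agree n.+1 (f \cdot I) (g \cdot I).
Proof.
move=> fg s; case/lastP: s => [|s x]; rewrite ?mid_mmul_nil // size_rcons ltnS.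
by move=> lt_s; rewrite !mmul_mid_rcons fg.
Qed.

(** The n-th iterate is stationary in degrees below n, so the limit may be read in
    degree n off the (n + 1)-st iterate. It is multilinear because words that
    differ in one letter have the same length, so that one iterate computes them
    all. *)
Lemma contraction_fixpoint (Phi : Mult B -> Mult B) :
  (forall n f g, agree n f g -> agree n.+1 (Phi f) (Phi g)) ->
  exists f, Phi f = f.
Proof.
move=> PhiP; pose it n := iter n Phi mone.
have it_agree m n : agree m (it m) (it (m + n)%N).
  by elim: m => [|m IH]; [move=> s | apply: PhiP].
have lim_ml : multilinear (fun s => it (size s).+1 s).
  by move=> s t a x y; rewrite !size_cat; apply: (mfunP (it _)).
exists (MkMult lim_ml); apply: MultP => s; rewrite [RHS]/=.
apply: (PhiP (size s)) => // t lt_t.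
have := it_agree (size t).+1 (size s - (size t).+1)%N t (ltnSn _).
by rewrite subnKC.
Qed.

(** A Newton step g + b (1 - f g) for the equation f g = 1: if b f_0 = 1, it
    cancels the dependence of degree n on g_n, and its fixed points solve the
    equation if f_0 b = 1. *)
Lemma newton_subproof f b g :
  multilinear (fun s => g s + b * ((mone : Mult B) s - (f \cdot g) s)).
Proof.
move=> s t a x y.
rewrite (mfunP g) (mfunP mone) (mfunP (f \cdot g)).
rewrite opprD addrACA -scalerN -scalerDr mulrDr -scalerAr addrACA.
by rewrite -scalerDr.
Qed.

(** The inverse found is again invertible, hence has a right inverse of its own;
    [minvP] deduces from this that it is two-sided. *)
Lemma mmul_right_inverse f : Ginv f -> exists2 g, Ginv g & f \cdot g = mone.
Proof.
move=> [b [fb bf]].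
have [n g g' gg' s lt_s|g Hg] :=
    @contraction_fixpoint (fun g => MkMult (newton_subproof f b g)).
  rewrite [LHS]/= [RHS]/= -[mmul_fun f g s]/((f \cdot g) s).
  rewrite -[mmul_fun f g' s]/((f \cdot g') s) !mmul_dsum.
  case: s lt_s => [|x s] /= lt_s.
    by rewrite !addr0 !mulrBr !mulrA bf !mul1r mulr1 !(addrC _ (b - _)) !subrK.
  rewrite !sub0r !mulrN !mulrDr !mulrA bf !mul1r !opprD !addrA !subrr !add0r.
  congr (- (b * _)); apply: eq_dsum => u v s_uv; rewrite gg' //.
  by apply: (@leq_ltn_trans (size s)) => //; rewrite s_uv size_cat leq_addl.
have fg : f \cdot g = mone.
  apply: MultP => s; have := congr1 (fun a : Mult B => a s) Hg => /=.
  rewrite -[RHS]addr0 => /addrI /(congr1 (fun c => f [::] * c)).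
  by rewrite mulr0 mulrA fb mul1r => /eqP; rewrite subr_eq0 => /eqP <-.
exists g => //; exists (f [::]).
have fg0 : f [::] * g [::] = 1 by rewrite -mmul_nil fg.
split=> //; suff -> : g [::] = b by [].
by rewrite -[RHS]mulr1 -fg0 mulrA bf mul1r.
Qed.

Lemma minvP f : Ginv f ->
  [/\ Ginv (minv f), f \cdot minv f = mone & minv f \cdot f = mone].
Proof.
move=> fG; have [g gG fg] := mmul_right_inverse fG.
have [h _ gh] := mmul_right_inverse gG.
have fh : f = h by rewrite -[LHS]mmulf1 -gh mmulA fg mmul1f.
have ex : [set g | Ginv g /\ f \cdot g = mone /\ g \cdot f = mone]%classic g.
  by split=> //; rewrite {2}fh gh.
by have [? [? ?]] := xgetPex mone (ex_intro _ g ex).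
Qed.

Lemma minv_unique_r f g : Ginv f -> f \cdot g = mone -> g = minv f.
Proof.
by move=> /minvP[_ _ Vf] fg; rewrite -[LHS]mmul1f -Vf -mmulA fg mmulf1.
Qed.

Lemma minv_unique_l f g : Ginv f -> g \cdot f = mone -> g = minv f.
Proof.
by move=> /minvP[_ fV _] gf; rewrite -[LHS]mmulf1 -fV mmulA gf mmul1f.
Qed.

(** From f^-1 = f^-1 g g^-1 and g^-1 = f^-1 f g^-1, which differ only in the
    middle factor. *)
Lemma agree_minv n f g : Ginv f -> Ginv g ->
  agree n f g -> agree n (minv f) (minv g).
Proof.
move=> /minvP[_ _ Vf] /minvP[_ gV _] fg.
rewrite -[minv f]mmulf1 -gV -[X in agree n _ X]mmul1f -Vf -mmulA.
by apply: agree_mul => //; apply: agree_mul => // s lt_s; rewrite fg.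
Qed.

Lemma Ginv_comp f g : Ginv f -> Ginv (f \circ g).
Proof. by move=> [b fb]; exists b; rewrite mcompE_nil. Qed.

Lemma Ginv_mul f g : Ginv f -> Ginv g -> Ginv (f \cdot g).
Proof.
move=> [b [fb bf]] [c [gc cg]]; exists (c * b).
rewrite mmul_nil mulrA -(mulrA _ _ c) gc mulr1 fb; split=> //.
by rewrite mulrA -(mulrA c) bf mulr1 cg.
Qed.

Lemma Gdif_mid_l F : Ginv F -> Gdif (I \cdot F).
Proof.
move=> [b [Fb bF]]; split; first exact: mmul_mid_nil.
by exists (fun x => x * b) => x; rewrite mmul_mid_cons -mulrA ?Fb ?bF mulr1.
Qed.

Lemma Gdif_mid_r F : Ginv F -> Gdif (F \cdot I).
Proof.
move=> [b [Fb bF]]; split; first exact: mid_mmul_nil.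
have FI x : (F \cdot I) [:: x] = F [::] * x by exact: (mmul_mid_rcons F [::]).
by exists (fun x => b * x) => x; rewrite FI mulrA ?Fb ?bF mul1r.
Qed.

(** If g is a right inverse of f and has a right inverse h itself, then f = h and
    g is two-sided. *)
Lemma mcinvP f g h : Gdif f -> Gdif g -> f \circ g = I -> g \circ h = I ->
  [/\ Gdif (mcinv f), f \circ mcinv f = I & mcinv f \circ f = I].
Proof.
move=> fG gG fg gh.
have fh : f = I \circ h by rewrite -fg -mcompA gh mcompf1.
have gf : g \circ f = I by rewrite fh mcompA mcompf1 gh.
have ex : [set g | Gdif g /\ f \circ g = I /\ g \circ f = I]%classic g by [].
by have [? [? ?]] := xgetPex I (ex_intro _ g ex).
Qed.

(** (I F) \circ (I A) = I A (F \circ (I A)), so A must be the multiplicative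
    inverse of F \circ (I A). The multiplication by I shifts degrees by one, which
    makes this fixed point equation contracting. *)
Lemma mid_l_right_inverse F : Ginv F ->
  exists2 A, Ginv A & (I \cdot F) \circ (I \cdot A) = I.
Proof.
move=> FG; have FcG A : Ginv (F \circ (I \cdot A)) by apply: Ginv_comp.
have [n A A' AA'|A HA] :=
    @contraction_fixpoint (fun A => minv (F \circ (I \cdot A))).
  by apply: agree_minv => //; apply: agree_comp; apply: agree_mid_l.
have [VG _ VF] := minvP (FcG A).
exists A; first by rewrite -HA.
rewrite mmul_comp mcomp1f ?mmul_mid_nil // -mmulA -{1}HA VF.
exact: mmulf1.
Qed.

Lemma mid_r_right_inverse F : Ginv F ->
  exists2 A, Ginv A & (F \cdot I) \circ (A \cdot I) = I.
Proof.
move=> FG; have FcG A : Ginv (F \circ (A \cdot I)) by apply: Ginv_comp.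
have [n A A' AA'|A HA] :=
    @contraction_fixpoint (fun A => minv (F \circ (A \cdot I))).
  by apply: agree_minv => //; apply: agree_comp; apply: agree_mid_r.
have [VG FV _] := minvP (FcG A).
exists A; first by rewrite -HA.
rewrite mmul_comp mcomp1f ?mid_mmul_nil // mmulA -{2}HA FV.
exact: mmul1f.
Qed.

(** The default-valued inverses in the definition of S_l are handled here once and
    for all: everything else about S_l follows from this property. *)
Lemma S_lP F : Ginv F ->
  [/\ Ginv (S_l F), (I \cdot F) \circ (I \cdot S_l F) = I &
      (I \cdot S_l F) \circ (I \cdot F) = I].
Proof.
move=> FG; have [A AG FA] := mid_l_right_inverse FG.
have [A' _ AA'] := mid_l_right_inverse AG.
have [[J0 _] FJ JF] := mcinvP (Gdif_mid_l FG) (Gdif_mid_l AG) FA AA'.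
have [VG FV _] := minvP FG.
suff IS : I \cdot S_l F = mcinv (I \cdot F).
  by rewrite IS; split=> //; apply: Ginv_comp.
rewrite /S_l -{1}FJ mmul_comp -mmulA -mmul_comp FV mone_comp mmulf1.
by rewrite mcomp1f.
Qed.

Lemma S_rP F : Ginv F ->
  [/\ Ginv (S_r F), (F \cdot I) \circ (S_r F \cdot I) = I &
      (S_r F \cdot I) \circ (F \cdot I) = I].
Proof.
move=> FG; have [A AG FA] := mid_r_right_inverse FG.
have [A' _ AA'] := mid_r_right_inverse AG.
have [[J0 _] FJ JF] := mcinvP (Gdif_mid_r FG) (Gdif_mid_r AG) FA AA'.
have [VG _ VF] := minvP FG.
suff IS : S_r F \cdot I = mcinv (F \cdot I).
  by rewrite IS; split=> //; apply: Ginv_comp.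
rewrite /S_r -{2}FJ mmul_comp mmulA -mmul_comp VF mone_comp mmul1f.
by rewrite mcomp1f.
Qed.

Lemma S_l_unique F X : Ginv F -> (I \cdot F) \circ (I \cdot X) = I -> X = S_l F.
Proof.
move=> /S_lP[_ _ SF] FX; apply: mid_cancel_l.
by rewrite -[LHS]mcomp1f ?mmul_mid_nil // -{1}SF -mcompA FX mcompf1.
Qed.

Lemma S_r_unique F X : Ginv F -> (F \cdot I) \circ (X \cdot I) = I -> X = S_r F.
Proof.
move=> /S_rP[_ _ SF] FX; apply: mid_cancel_r.
by rewrite -[LHS]mcomp1f ?mid_mmul_nil // -{1}SF -mcompA FX mcompf1.
Qed.

Lemma S_l_comp_mul F : Ginv F -> S_l F \cdot F \circ (I \cdot S_l F) = mone.
Proof.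
move=> /S_lP[_ FS _]; apply: mid_cancel_l.
by rewrite mmulA -{1}(mcomp1f (mmul_mid_nil _)) -mmul_comp FS mmulf1.
Qed.

(** Half of the composition identity (I F) \circ (I S_l F) = I with the factor I
    removed; this is what turns composition inverses into multiplicative ones. *)
Lemma S_l_comp_inv F : Ginv F -> F \circ (I \cdot S_l F) = minv (S_l F).
Proof.
by move=> FG; have [SG _ _] := S_lP FG; apply: minv_unique_r (S_l_comp_mul FG).
Qed.

Lemma S_r_comp_inv F : Ginv F -> S_r F \circ (F \cdot I) = minv F.
Proof.
move=> FG; have [_ _ SF] := S_rP FG; apply: minv_unique_l => //.
apply: mid_cancel_r.
by rewrite -mmulA -{2}(mcomp1f (mid_mmul_nil F)) -mmul_comp SF mmul1f.
Qed.

(** * The two formulas for the boxed convolution *)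

Lemma boxed_star_l F G : Ginv F -> Ginv G ->
  boxed F G = star_l G (S_l (act_r G (S_l F))).
Proof.
move=> FG GG; have [AG _ _] := S_lP FG; have [CG GC CG'] := S_lP GG.
set A := S_l F in AG *; set C := S_l G in CG GC CG' *.
pose E := act_r G A; have EG : Ginv E by apply: Ginv_comp.
have [DG ED _] := S_lP EG; set D := S_l E in DG ED *.
have bulletE : I \cdot bullet A C = (I \cdot E) \circ (I \cdot C).
  rewrite /bullet -(S_l_comp_inv GG) -/C mmul_comp mcomp1f ?mmul_mid_nil //.
  rewrite mmulA; congr (_ \cdot _); rewrite /E /act_r -mcompA.
  by rewrite mmul_comp mcomp1f ?mmul_mid_nil // mmulA.
have starE : I \cdot star_l G D = (I \cdot G) \circ (I \cdot D).
  by rewrite mmul_comp mcomp1f ?mmul_mid_nil // mmulA.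
apply/esym; apply: S_l_unique; first by apply/Ginv_mul/Ginv_comp.
rewrite bulletE starE -mcompA (mcompA (I \cdot C)) CG'.
by rewrite (mcomp1f (mmul_mid_nil _)).
Qed.

Lemma star_l_star_r F G : Ginv F -> Ginv G ->
  star_l G (S_l (act_r G (S_l F))) = star_r F (S_r (act_l F (S_r G))).
Proof.
move=> FG GG; have [AG _ _] := S_lP FG; have [BG _ _] := S_rP GG.
set A := S_l F in AG *; set E := act_r G A.
have EG : Ginv E by apply: Ginv_comp.
have [DG ED _] := S_lP EG; set D := S_l E in DG ED *.
pose X := G \circ (I \cdot D); have XG : Ginv X by apply: Ginv_comp.
(* w is the common value of X I D and (I F) \circ (X I): the second form is
   only available once D = F \circ (X I) is known. *)
pose w := (G \cdot I) \circ (I \cdot D).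
have wE : w = X \cdot I \cdot D.
  by rewrite /w mmul_comp mcomp1f ?mmul_mid_nil // mmulA.
have AwG : Ginv (A \circ w) by apply: Ginv_comp.
have DAw : D \cdot A \circ w = mone.
  by rewrite -(S_l_comp_mul EG) /E /act_r -mcompA.
have IAw : (I \cdot A) \circ w = X \cdot I.
  rewrite mmul_comp mcomp1f ?wE; last by rewrite -mmulA mmul_nil mmul_mid_nil mulr0.
  by rewrite -wE {1}wE -mmulA DAw mmulf1.
have DE : D = F \circ (X \cdot I).
  rewrite (minv_unique_l AwG DAw); apply/esym; apply: minv_unique_l => //.
  rewrite -IAw mcompA (S_l_comp_inv FG) -mmul_comp.
  by have [_ _ ->] := minvP AG; rewrite mone_comp.
suff XE : X = S_r (act_l F (S_r G)) by rewrite /star_l /star_r -XE {1}DE.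
apply: S_r_unique; first exact: Ginv_comp.
rewrite mmul_comp mcomp1f ?mid_mmul_nil // /act_l -mcompA.
have -> : (I \cdot F) \circ (X \cdot I) = w.
  by rewrite mmul_comp mcomp1f ?mid_mmul_nil // -DE -wE.
rewrite mcompA (S_r_comp_inv GG) mmulA -mmul_comp.
by have [_ _ ->] := minvP GG; rewrite mone_comp mmul1f.
Qed.

End Inverses.

Theorem proposition3p23 (K : fieldType) (charK : [pchar K] =i pred0)
    (B : algType K) (F G : Mult B) (hF : Ginv F) (hG : Ginv G) :
  boxed F G = star_l G (S_l (act_r G (S_l F))) /\
  boxed F G = star_r F (S_r (act_l F (S_r G))).
Proof. by split; rewrite boxed_star_l // star_l_star_r. Qed.
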